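(* Let $\mathbb K$ be an algebraically closed field of characteristic $0$, and let $(\mathfrak g,B)$ be a finite-dimensional quadratic Lie algebra over $\mathbb K$ which admits an invertible derivation $\overline D$ that is skew-symmetric with respect to $B$. Then there exist a Lie algebra $\mathfrak a$ over $\mathbb K$, an invertible derivation $D$ of $\mathfrak a$, and a cyclic $2$-cocycle $\theta\in Z^2(\mathfrak a,\mathfrak a^* )$ such that $(\mathfrak g,B)$ is isometrically isomorphic to the $T^*$-extension $T^*_\theta\mathfrak a$, and such that the map $\Theta:\mathfrak a\times\mathfrak a\times\mathfrak a\to\mathbb K$ defined by $$\Theta(x,y,z)=\theta(Dx,y)(z)+\theta(Dy,z)(x)+\theta(Dz,x)(y),\qquad x,y,z\in\mathfrak a,$$ is a $3$-coboundary for the scalar cohomology of $\mathfrak a$.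
   Context: All Lie algebras are finite-dimensional over a field $\mathbb K$ of characteristic $0$. A quadratic Lie algebra $(\mathfrak g,B)$ is a Lie algebra $\mathfrak g$ with a non-degenerate symmetric bilinear form $B$ such that $B([x,y],z)=B(x,[y,z])$ for all $x,y,z$. A derivation $D$ of $\mathfrak g$ is skew-symmetric if $B(Dx,y)=-B(x,Dy)$ for all $x,y$. Two quadratic Lie algebras are isometrically isomorphic if there is a Lie algebra isomorphism between them preserving the bilinear forms. For a Lie algebra $\mathfrak a$, a $2$-cocycle $\theta\in Z^2(\mathfrak a,\mathfrak a^* )$ (values in the coadjoint module) is a skew-symmetric bilinear map $\theta:\mathfrak a\times\mathfrak a\to\mathfrak a^*$ such that the cyclic sum over $(x,y,z)$ of $\theta([x,y],z)+\theta(x,y)\circ\mathrm{ad}(z)$ vanishes. It is cyclic if $\theta(x,y)(z)=\theta(y,z)(x)$ for all $x,y,z\in\mathfrak a$. The $T^*$-extension $T^*_\theta\mathfrak a$ is the vector space $\mathfrak a\oplus\mathfrak a^*$ with bracket $$[x+f,y+g]=[x,y]_{\mathfrak a}+\theta(x,y)+f\circ\mathrm{ad}_{\mathfrak a}(y)-g\circ\mathrm{ad}_{\mathfrak a}(x),\quad x,y\in\mathfrak a,\ f,g\in\mathfrak a^*;$$ when $\theta$ is cyclic it is a quadratic Lie algebra for the form $B(x+f,y+g)=f(y)+g(x)$. Scalar cohomology is Chevalley–Eilenberg cohomology with coefficients in the trivial module $\mathbb K$: an alternating trilinear form $\Theta$ on $\mathfrak a$ is a $3$-coboundary if there is an alternating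 bilinear form $F$ on $\mathfrak a$ with $\Theta(x,y,z)=F([x,y],z)+F([y,z],x)+F([z,x],y)$ for all $x,y,z$ (up to an overall sign convention). *)

(* Defs.v *)
From HB Require Import structures.
From mathcomp Require Import all_boot all_order all_algebra.
From mathcomp Require Import ring.

Set Implicit Arguments.
Unset Strict Implicit.
Unset Printing Implicit Defensive.

Import GRing.Theory.
Local Open Scope ring_scope.

HB.mixin Record Vector_isLieAlgebra (K : fieldType) L of Vector K L := {
  lie_bracket : {bilinear L -> L -> L};
  lie_alternating : forall x : L, lie_bracket x x = 0;
  lie_jacobi : forall x y z : L,
    lie_bracket (lie_bracket x y) z + lie_bracket (lie_bracket y z) x
      + lie_bracket (lie_bracket z x) y = 0
}.

#[short(type="lieAlgType")]
HB.structure Definition LieAlgebra (K : fieldType) :=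
  { L of Vector K L & Vector_isLieAlgebra K L }.

Notation "[lie x , y ]" := (lie_bracket x y)
  (at level 0, x, y at level 99, format "[lie  x ,  y ]") : ring_scope.

Section LieTheory.
Variables (K : fieldType) (g : lieAlgType K).
Implicit Types (x y z : g) (D : 'End(g)) (B : {symmetric g}).

Definition ad x : 'End(g) := linfun (lie_bracket x).

Lemma adE x y : ad x y = [lie x, y].
Proof. by rewrite lfunE. Qed.

Lemma lie_anticomm x y : [lie x, y] = - [lie y, x].
Proof.
apply/eqP; rewrite -addr_eq0; apply/eqP; rewrite -[RHS](lie_alternating (x + y)).
by rewrite linearDl !linearDr !lie_alternating addr0 add0r.
Qed.

Lemma lie_bracketA x y z :
  [lie [lie x, y], z] = [lie x, [lie y, z]] - [lie y, [lie x, z]].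
Proof.
have /eqP := lie_jacobi x y z; rewrite -addrA addr_eq0 => /eqP->.
rewrite (lie_anticomm _ x) (lie_anticomm _ y) (lie_anticomm z x) linearNr.
by rewrite opprD !opprK.
Qed.

Definition is_derivation D :=
  forall x y, D [lie x, y] = [lie D x, y] + [lie x, D y].

Definition is_skew_wrt B D := forall x y, B (D x) y = - B x (D y).

Definition is_quadratic B :=
  nondegenerate B /\ forall x y z, B [lie x, y] z = B x [lie y, z].

(* With the opposite sign convention F is replaced by - F. *)
Definition is_3coboundary (T : g -> g -> g -> K) :=
  exists F : {biscalar g},
    (forall x, F x x = 0) /\
    (forall x y z, T x y z = F [lie x, y] z + F [lie y, z] x + F [lie z, x] y).

End LieTheory.

Definition isometrically_isomorphic (K : fieldType) (g h : lieAlgType K)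
    (Bg : {symmetric g}) (Bh : {symmetric h}) :=
  exists phi : 'Hom(g, h),
    [/\ bijective phi,
        forall x y, phi [lie x, y] = [lie phi x, phi y] &
        forall x y, Bh (phi x) (phi y) = Bg x y].

Section Cocycles.
Variables (K : fieldType) (a : lieAlgType K).
Implicit Type theta : {bilinear a -> a -> 'Hom(a, K^o)}.

Definition cocycle_term theta (x y z : a) : 'Hom(a, K^o) :=
  theta [lie x, y] z + (theta x y \o ad z)%VF.

Definition is_2cocycle theta :=
  (forall x y, theta x y = - theta y x) /\
  (forall x y z,
     cocycle_term theta x y z + cocycle_term theta y z x
       + cocycle_term theta z x y = 0).

Definition is_cyclic theta := forall x y z, theta x y z = theta y z x.

End Cocycles.

Section TstarExtension.
Variables (K : fieldType) (K0 : [pchar K] =i pred0) (a : lieAlgType K).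
Variables (theta : {bilinear a -> a -> 'Hom(a, K^o)}).
Variable theta_cocycle : is_2cocycle theta.

(* The two proofs are arguments of the type because the Lie algebra structure
   depends on them: the characteristic is used to get [u, u] = 0 from the
   skew-symmetry of theta. *)
Definition Tstar of [pchar K] =i pred0 & is_2cocycle theta : Type :=
  (a * 'Hom(a, K^o))%type.
Local Notation T := (Tstar K0 theta_cocycle).

HB.instance Definition _ := Vector.copy T (a * 'Hom(a, K^o))%type.

Definition Tstar_bracket (u v : T) : T :=
  ([lie u.1, v.1], theta u.1 v.1 + (u.2 \o ad v.1)%VF - (v.2 \o ad u.1)%VF).

Lemma Tstar_bracketE (u v : T) (z : a) :
  (Tstar_bracket u v).2 z =
    theta u.1 v.1 z + u.2 [lie v.1, z] - v.2 [lie u.1, z] :> K.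
Proof. by rewrite !(add_lfunE, opp_lfunE, comp_lfunE, adE). Qed.

Lemma Tstar_eqP (u v : T) :
  u.1 = v.1 -> (forall z, u.2 z = v.2 z :> K) -> u = v.
Proof.
by case: u v => [x f] [y g] /= -> fg; congr (_, _); apply/lfunP=> z; apply: fg.
Qed.

Fact Tstar_bracket_bilinear :
  bilinear_for (GRing.Scale.Law.clone _ _ *:%R _)
    (GRing.Scale.Law.clone _ _ *:%R _) Tstar_bracket.
Proof.
split=> w c u v; apply: Tstar_eqP => [|z] /=; rewrite ?linearPl ?linearPr //.
  rewrite !(add_lfunE, opp_lfunE, scale_lfunE, comp_lfunE, adE) /=.
  rewrite !linearPl linearP /=.
  rewrite /GRing.scale /=; ring.
rewrite !(add_lfunE, opp_lfunE, scale_lfunE, comp_lfunE, adE) /=.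
rewrite linearPl linearP /=.
rewrite /GRing.scale /=; ring.
Qed.

HB.instance Definition _ :=
  bilinear_isBilinear.Build K T T T _ _ Tstar_bracket Tstar_bracket_bilinear.

Fact Tstar_alternating (u : T) : Tstar_bracket u u = 0.
Proof.
have two0 : 2%:R != 0 :> K by rewrite (pcharf0P _).1.
apply: Tstar_eqP => [|z] /=; first exact: lie_alternating.
rewrite Tstar_bracketE addrK lfunE /=; apply/eqP.
rewrite -(mulrI_eq0 (theta u.1 u.1 z : K) (mulfI two0)) mulr_natl mulr2n.
by rewrite {1}(theta_cocycle.1 u.1 u.1) opp_lfunE addNr.
Qed.

Fact Tstar_jacobi (u v w : T) :
  Tstar_bracket (Tstar_bracket u v) w + Tstar_bracket (Tstar_bracket v w) u
    + Tstar_bracket (Tstar_bracket w u) v = 0.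
Proof.
apply: Tstar_eqP => [|z] /=; first exact: lie_jacobi.
have := theta_cocycle.2 u.1 v.1 w.1 => /lfunP/(_ z).
rewrite !(add_lfunE, opp_lfunE, zero_lfunE, comp_lfunE, adE) => cocyc.
rewrite !(lie_bracketA _ _ z) !linearB -[RHS]cocyc /=; ring.
Qed.

HB.instance Definition _ :=
  Vector_isLieAlgebra.Build K T Tstar_alternating Tstar_jacobi.

Definition Tstar_form (u v : T) : K := u.2 v.1 + v.2 u.1.

Fact Tstar_form_bilinear :
  bilinear_for (GRing.Scale.Law.clone _ _ *%R _)
    (GRing.Scale.Law.clone _ _ (idfun \; *%R) _) Tstar_form.
Proof.
split=> w c u v /=; rewrite /Tstar_form /= linearP /= add_lfunE scale_lfunE;
  rewrite /GRing.scale /=; ring.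
Qed.

HB.instance Definition _ :=
  bilinear_isBilinear.Build K T T K _ _ Tstar_form Tstar_form_bilinear.

Fact Tstar_form_symmetric (u v : T) :
  Tstar_form u v = (-1) ^+ false * idfun (Tstar_form v u).
Proof. by rewrite expr0 mul1r /Tstar_form addrC. Qed.

Lemma Tstar_form_invariant (u v w : T) : is_cyclic theta ->
  Tstar_form (Tstar_bracket u v) w = Tstar_form u (Tstar_bracket v w).
Proof.
move=> theta_cyc; rewrite /Tstar_form !Tstar_bracketE /=.
rewrite (theta_cyc u.1) (lie_anticomm v.1 u.1) (lie_anticomm w.1 u.1).
rewrite !linearN /=; ring.
Qed.

HB.instance Definition _ :=
  isHermitianSesquilinear.Build K T false idfun Tstar_form Tstar_form_symmetric.

End TstarExtension.

Lemma Tstar_quadratic (K : fieldType) (K0 : [pchar K] =i pred0) (a : lieAlgType K)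
    (theta : {bilinear a -> a -> 'Hom(a, K^o)}) (thetaP : is_2cocycle theta) :
  is_cyclic theta -> is_quadratic (@Tstar_form K K0 a theta thetaP).
Proof.
move=> theta_cyc; split=> [|u v w].
  apply/eqP/vspaceP=> u; rewrite memv0; apply/idP/eqP=> [/mem_orthovP u_orth|->].
    have uP v : Tstar_form u v = 0 by apply: u_orth; rewrite memvf.
    apply: Tstar_eqP => [|z] /=; last first.
      by have := uP (z, 0); rewrite /Tstar_form /= !lfunE /= addr0.
    rewrite (coord_vbasis (memvf u.1)) big1 // => i _.
    have := uP (0, linfun (coord (vbasis fullv) i : a -> K^o)).
    by rewrite /Tstar_form /= linear0 add0r lfunE /= => ->; rewrite scale0r.
  exact: mem0v.
exact: Tstar_form_invariant.
Qed.

(* Main.v *)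
From HB Require Import structures.
Require Import Defs.
From mathcomp Require Import all_boot all_order all_algebra.
From mathcomp Require Import ring.
Set Implicit Arguments.
Unset Strict Implicit.
Unset Printing Implicit Defensive.
Import GRing.Theory.
Import passmx.
Local Open Scope ring_scope.

(** The heart of the matter is a Lagrangian ideal of g stable under Dbar: a
    stable ideal I equal to its own B-orthogonal ([lagrangian_ideal]).

    Such an ideal is reached by enlarging a stable isotropic ideal W one
    dimension at a time. As long as W is smaller than its orthogonal W', the
    nonzero quotient W'/W contains a vector v killed by g that is an
    eigenvector of Dbar, for an eigenvalue m. Since Dbar is invertible on W
    and on g, m is nonzero, and skewness gives m B(v,v) = - m B(v,v), so v is
    isotropic and W + Kv is again a stable isotropic ideal.

    That g has nonzero invariants in W'/W is Engel's theorem combined with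
    Jacobson's theorem that a Lie algebra with an invertible derivation is
    nilpotent. Both are proved at once, relative to a pair of stable subspaces
    U, W of g ([has_invariants_mod_full]): starting from k = 0, the stable
    subalgebra k is enlarged by an eigenvector x of Dbar in normalizer(k)/k.
    Its eigenvalue c is nonzero, so [ad x] moves an eigenvector of Dbar with
    eigenvalue b to one with eigenvalue b + c; as Dbar has finitely many
    eigenvalues, [ad x] is nilpotent on the k-invariants of (W + U)/U and has
    a nonzero kernel there ([has_invariants_mod_adjoin]).

    Given I, there is a projection pi of g with kernel I and isotropic image
    ([isotropic_splitting]). The image of pi carries the quotient Lie algebra
    a = g/I, with bracket pi [u, v]. The map u |-> (pi u, B(u, -)) identifies
    g with the T*-extension of a by theta(x,y)(z) = B([x,y],z)
    ([isometrically_isomorphic_Tstar]); Dbar induces D on a. The trilinear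
    form B([u,v],w) on g is annihilated by Dbar. Writing Dbar x = D x + h x,
    with h x in I, splits this relation into Theta and the coboundary of
    F(x,y) = B(h x, y) = B(Dbar x, y) ([derivation_cocycle_coboundary]). *)

(** * Operators modulo a stable subspace *)

Lemma natr_inj_pchar0 (K : fieldType) :
  [pchar K] =i pred0 -> injective (fun n => n%:R : K).
Proof.
move=> K0 m n; wlog le_mn : m n / (m <= n)%N.
  by move=> IH mn; have [/IH->|/ltnW/IH->] := leqP m n.
move=> /esym/eqP; rewrite -subr_eq0 -natrB // (pcharf0P K).1 // subn_eq0 => le_nm.
by apply/eqP; rewrite eqn_leq le_mn.
Qed.

(** Cayley-Hamilton, with the characteristic polynomial split into linear
    factors. Folding over the roots gives a meaning to the product also in
    dimension 0, where square matrices do not form a nontrivial ring. *)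
Lemma mx_shift_prod_eq0 (K : closedFieldType) n (M : 'M[K]_n) :
  exists s : seq K, forall u : 'rV_n, foldl (fun w a => w *m M - a *: w) u s = 0.
Proof.
case: n M => [|n] M; first by exists [::] => u; rewrite thinmx0.
have [s /= def_p] := closed_field_poly_normal (char_poly M).
exists s => u.
have p0 : \prod_(a <- s) (M - a%:M) = 0.
  have := Cayley_Hamilton M; rewrite def_p (monicP (char_poly_monic M)) scale1r.
  rewrite rmorph_prod /= => <-; apply: eq_bigr => a _.
  by rewrite rmorphB /= horner_mx_X horner_mx_C.
rewrite -[RHS](mulmx0 _ u) -p0; elim: (s) u => [|a t IH] u /=.
  by rewrite big_nil mulmx1.
by rewrite big_cons IH mulmxA mulmxBr mul_mx_scalar.
Qed.

Section StableSubspaces.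
Variables (K : fieldType) (V : vectType K) (T : 'End(V)).
Implicit Types (U : {vspace V}) (u v : V).

Definition stable U := forall u, u \in U -> T u \in U.

(** An injective operator is onto on each stable subspace, by dimension; hence
    it remains injective modulo that subspace. *)
Lemma stable_cancel U v : bijective T -> stable U -> T v \in U -> v \in U.
Proof.
move=> /bij_inj T_inj U_stable; have T0 : lker T == 0%VS by apply/lker0P.
suff /eqP UE : (T @: U == U)%VS by rewrite -[in X in X -> _]UE => /memv_imgP[u uU /T_inj->].
rewrite eqEdim limg_dim_eq ?leqnn ?(eqP T0) ?capv0 // andbT.
by apply/subvP=> _ /memv_imgP[u uU ->]; apply: U_stable.
Qed.

End StableSubspaces.

Section Spectrum.
Variables (K : closedFieldType) (V : vectType K) (T : 'End(V)).
Implicit Types (U W : {vspace V}) (u v w : V) (a b c : K) (s : seq K).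

Definition shift_prod s v := foldl (fun w a => T w - a *: w) v s.

Lemma shift_prod_eq0 : exists s, forall v, shift_prod s v = 0.
Proof.
pose e := vbasis {:V}; have e_basis : basis_of {:V} e := vbasisP _.
have [s s0] := mx_shift_prod_eq0 (mxof e e T); exists s => v.
apply/eqP; rewrite -(rVof_eq0 e_basis) -[X in _ == X](s0 (rVof e v)); apply/eqP.
elim: s {s0} v => //= a s IH v; rewrite /shift_prod /= in IH *.
by rewrite IH linearB linearZ /= (rVof_app e e_basis).
Qed.

(** Apply the factors T - a of an annihilating product one after the other to a
    vector of W outside U: the last vector that is still outside U is an
    eigenvector modulo U. *)
Lemma eigenvector_mod U W :
  stable T W -> ~~ (W <= U)%VS ->
  exists v a, [/\ v \in W, v \notin U & T v - a *: v \in U].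
Proof.
move=> W_stable /subvPn[w wW wU]; have [s /(_ w) s0] := shift_prod_eq0.
have {s0} : shift_prod s w \in U by rewrite s0 mem0v.
elim: s w wW wU => [|a s IH] w wW wU /=; first by rewrite (negPf wU).
have [Tw _|Tw] := boolP (T w - a *: w \in U); first by exists w, a.
by apply: IH => //; rewrite memvB ?memvZ ?W_stable.
Qed.

(** If p(T) = 0 then p(a) v lies in U for each eigenvector v modulo U of
    eigenvalue a, so a is a root of p. The list of roots does not depend
    on U. *)
Lemma finite_spectrum : exists s, forall U v a,
  stable T U -> v \notin U -> T v - a *: v \in U -> a \in s.
Proof.
have [s s0] := shift_prod_eq0; exists s => U v a U_stable vU Tv.
have shiftE t w c : w - c *: v \in U ->
    shift_prod t w - (c * \prod_(b <- t) (a - b)) *: v \in U.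
  elim: t w c => [|b t IH] w c w_cv; first by rewrite big_nil mulr1.
  rewrite big_cons mulrA; apply: IH.
  have -> : T w - b *: w - (c * (a - b)) *: v =
      T (w - c *: v) - b *: (w - c *: v) + c *: (T v - a *: v).
    have -> : T (w - c *: v) = T w - c *: T v by rewrite linearB linearZ.
    rewrite mulrBr scalerBl !scalerBr !scalerA (mulrC b c).
    rewrite [RHS]addrAC subrKA !opprB addrACA [RHS]addrACA.
    by congr (_ + _); rewrite addrC.
  by rewrite memvD ?memvB ?memvZ ?U_stable.
have := shiftE s v 1; rewrite s0 scale1r subrr mem0v mul1r sub0r memvN.
move=> /(_ isT); have [p0 _|p0] := eqVneq (\prod_(b <- s) (a - b)) 0.
  move/eqP: p0; rewrite prodf_seq_eq0 => /hasP[b bs] /=.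
  by rewrite subr_eq0 => /eqP->.
move=> pv; have := memvZ (\prod_(b <- s) (a - b))^-1 pv.
by rewrite scalerK // (negPf vU).
Qed.

End Spectrum.

(** * Invariants of a Lie algebra with an invertible derivation *)

Section EngelJacobson.
Variables (K : closedFieldType) (K0 : [pchar K] =i pred0) (g : lieAlgType K).
Variables (D : 'End(g)) (D_der : is_derivation D) (D_bij : bijective D).
Implicit Types (k U W : {vspace g}) (x y v w : g).

Definition acts_on k U := forall x u, x \in k -> u \in U -> [lie x, u] \in U.

(** For U = k this is the normalizer of k; if k acts on U, it is the preimage
    of the k-invariants of g/U. *)
Definition transporter k U :=
  (\bigcap_(i < \dim k) (ad (vbasis k)`_i @^-1: U))%VS.

Lemma transporterP k U v :
  reflect (forall x, x \in k -> [lie x, v] \in U) (v \in transporter k U).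
Proof.
apply: (iffP idP) => [v_tr x xk|tr_v].
  rewrite (coord_vbasis xk) linear_sumlz memv_suml //= => i _.
  rewrite linearZl /= memvZ //.
  move: v_tr; rewrite memvE => /subv_bigcapP/(_ i isT).
  by rewrite -memvE -memv_preim adE.
rewrite memvE; apply/subv_bigcapP => i _; rewrite -memvE -memv_preim adE.
by apply: tr_v; rewrite vbasis_mem ?mem_nth ?size_tuple.
Qed.

Lemma transporter_stable k U :
  stable D k -> stable D U -> stable D (transporter k U).
Proof.
move=> kD UD v /transporterP v_tr; apply/transporterP => x xk.
have -> : [lie x, D v] = D [lie x, v] - [lie D x, v] by rewrite D_der addrC addKr.
by rewrite memvB ?UD ?v_tr ?kD.
Qed.

(** The conclusion of Engel's theorem for all the subquotients (W + U)/U of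
    the adjoint representation. No other modules need be considered: the
    induction on k uses g/k, and the application uses the quotient of the
    orthogonal of an isotropic ideal by that ideal. *)
Definition has_invariants_mod k := forall U W,
  stable D U -> stable D W -> acts_on k U -> acts_on k W -> ~~ (W <= U)%VS ->
  ~~ (W :&: transporter k U <= U)%VS.

Lemma stableI U W : stable D U -> stable D W -> stable D (U :&: W)%VS.
Proof.
by move=> UD WD v; rewrite !memv_cap => /andP[vU vW]; rewrite UD ?WD.
Qed.

Lemma stable_adjoin k x c :
  stable D k -> D x - c *: x \in k -> stable D (k + <[x]>)%VS.
Proof.
move=> kD Dx _ /memv_addP[y yk [_ /vlineP[b ->] ->]].
have -> : D (y + b *: x) = D y + b *: (D x - c *: x) + (b * c) *: x.
  by rewrite linearD linearZ /= scalerBr scalerA -addrA subrK.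
by rewrite memv_add ?memvD ?memvZ ?kD ?memv_line.
Qed.

(** On the k-invariants of (W + U)/U the derivation satisfies [D, ad x] = c ad x, so
    [ad x] shifts eigenvalues of D by c. If it had no kernel there, D would
    have the infinitely many eigenvalues a + n c. *)
Lemma has_invariants_mod_adjoin k x c :
    stable D k -> x \in transporter k k -> D x - c *: x \in k -> c != 0 ->
  has_invariants_mod k -> has_invariants_mod (k + <[x]>)%VS.
Proof.
move=> kD /transporterP kx Dx c0 k_inv U W UD WD kU kW WU.
have xk' : x \in (k + <[x]>)%VS by rewrite memvE addvSr.
have kk' y : y \in k -> y \in (k + <[x]>)%VS by apply/subvP/addvSl.
set N := (W :&: transporter k U)%VS.
have NU : ~~ (N <= U)%VS
  by apply: k_inv => // y u /kk' yk' uUW; [apply: kU|apply: kW].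
have ND : stable D N by apply/stableI/transporter_stable.
have Nx v : v \in N -> [lie x, v] \in N.
  rewrite !memv_cap => /andP[vW /transporterP v_tr].
  rewrite kW //=; apply/transporterP => y yk.
  have -> : [lie y, [lie x, v]] = [lie [lie y, x], v] + [lie x, [lie y, v]].
    by rewrite lie_bracketA subrK.
  by apply: memvD; [apply/v_tr/kx|apply: kU => //; apply: v_tr].
have [[v [vN vU xvU]]|noker] : (exists v, [/\ v \in N, v \notin U & [lie x, v] \in U])
    \/ (forall v, v \in N -> v \notin U -> [lie x, v] \notin U).
- have [sub|/subvPn[v]] := boolP (N :&: (ad x @^-1: U) <= U)%VS.
    right=> v vN vU; apply: contra vU => xvU; apply: (subvP sub).
    by rewrite memv_cap vN -memv_preim adE.
  by rewrite memv_cap -memv_preim adE => /andP[? ?] ?; left; exists v.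
- apply/subvPn; exists v => //; move: vN; rewrite !memv_cap => /andP[-> v_tr] /=.
  apply/transporterP => _ /memv_addP[y yk [_ /vlineP[b ->] ->]].
  rewrite linearDl linearZl /= memvD ?memvZ //.
  exact: (transporterP _ _ _ v_tr).
have [w [a [wN wU Dw]]] := eigenvector_mod ND NU.
have [s spec] := finite_spectrum D.
have a_spec n : a + n%:R * c \in s.
  suff [v [_ vU Dv]] : exists v, [/\ v \in N, v \notin U &
      D v - (a + n%:R * c) *: v \in U] by apply: spec Dv.
  elim: n => [|n [v [vN vU Dv]]]; first by exists w; rewrite mul0r addr0.
  exists [lie x, v]; split; [exact: Nx|exact: noker|].
  have -> : D [lie x, v] - (a + n.+1%:R * c) *: [lie x, v] =
      [lie D x - c *: x, v] + [lie x, D v - (a + n%:R * c) *: v].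
    rewrite D_der linearBl linearBr linearZl linearZr /=.
    rewrite -natr1 mulrDl mul1r addrA [in LHS]scalerDl opprD.
    by rewrite addrACA addrACA [in RHS]addrACA (addrC (- (c *: _))).
  move: vN; rewrite memv_cap => /andP[_ /transporterP v_tr].
  by rewrite memvD ?v_tr ?kU.
(* one eigenvalue too many: they are distinct in characteristic 0 *)
pose weights := [seq a + n%:R * c | n <- iota 0 (size s).+1].
have uniq_weights : uniq weights.
  rewrite map_inj_uniq ?iota_uniq // => m n /addrI /(mulIf c0).
  exact: natr_inj_pchar0.
have : (size weights <= size s)%N.
  by apply: (uniq_leq_size uniq_weights) => _ /mapP[n _ ->].
by rewrite size_map size_iota ltnn.
Qed.

(** Induction on the codimension of the subalgebra k: the invariants of k in
    g/k form normalizer(k)/k, which is therefore nonzero and provides the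
    next vector to adjoin. *)
Lemma has_invariants_mod_full : has_invariants_mod fullv.
Proof.
suff ext m k : (\dim {:g} - \dim k <= m)%N -> stable D k -> acts_on k k ->
    has_invariants_mod k -> has_invariants_mod fullv.
  have mem0 v : v \in 0%VS -> v = 0 :> g by rewrite memv0 => /eqP.
  apply: (ext _ 0%VS (leqnn _)) => [u /mem0->|x u /mem0-> _|U W _ _ _ _].
  - by rewrite linear0 mem0v.
  - by rewrite linear0l mem0v.
  case/subvPn=> v vW vU; apply/subvPn; exists v => //.
  rewrite memv_cap vW; apply/transporterP => x /mem0->.
  by rewrite linear0l mem0v.
elim: m k => [|m IH] k dimk kD kk k_inv;
  have [/eqP<- //|k_proper] := boolP (k == fullv).
  by case/negP: k_proper; rewrite eqEdim subvf -subn_eq0 -leqn0.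
have not_full : ~~ (fullv <= k)%VS by apply: contra k_proper; rewrite eqEsubv subvf.
have [x [c [xN xk Dx]]] : exists x c,
    [/\ x \in transporter k k, x \notin k & D x - c *: x \in k].
  apply: eigenvector_mod; first exact: transporter_stable.
  rewrite -(capfv (transporter k k)); apply: k_inv => // v *; exact: memvf.
(* otherwise D x would lie in k, and D is invertible on k *)
have c0 : c != 0.
  apply: contraNneq xk => c0; apply: (stable_cancel D_bij kD).
  by rewrite c0 scale0r subr0 in Dx.
have lt_dim : (\dim k < \dim (k + <[x]>))%N.
  rewrite ltn_neqAle dimvS ?addvSl // andbT; apply: contra xk => /eqP eq_dim.
  have /eqP-> : k == (k + <[x]>)%VS by rewrite eqEdim addvSl -eq_dim /=.
  by rewrite memvE addvSr.
apply: (IH (k + <[x]>)%VS).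
- by rewrite -ltnS (leq_trans _ dimk) // ltn_sub2l // (leq_trans lt_dim) ?dimvS ?subvf.
- exact: stable_adjoin Dx.
- move=> _ _ /memv_addP[y yk [_ /vlineP[b ->] ->]] /memv_addP[z zk [_ /vlineP[b' ->] ->]].
  have/transporterP kx := xN.
  apply: (subvP (addvSl k <[x]>%VS)).
  rewrite linearDl !linearDr !linearZl !linearZr /= lie_alternating !scaler0 addr0.
  by rewrite (lie_anticomm x z) !memvD ?memvZ ?memvN ?kx ?kk.
exact: (has_invariants_mod_adjoin kD xN Dx c0 k_inv).
Qed.

End EngelJacobson.

(** * Symmetric forms and isotropic complements *)

Lemma lfun_of_linear (K : fieldType) (U V : vectType K) (f : U -> V) :
  linear f -> exists F : 'Hom(U, V), F =1 f.
Proof.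
move=> f_lin.
pose fL : {linear U -> V} := HB.pack f (GRing.isLinear.Build K U V *:%R f f_lin).
by exists (linfun fL) => u; rewrite lfunE.
Qed.

Section SymmetricForm.
Variables (K : fieldType) (V : vectType K) (B : {symmetric V}).
Implicit Types (u v : V).

Lemma symmetric_formC u v : B u v = B v u.
Proof. by rewrite hermC expr0 mul1r. Qed.

Definition form_dual_fun v : 'Hom(V, K^o) := linfun (applyr B v : V -> K^o).

Lemma form_dual_funE u v : form_dual_fun u v = B u v.
Proof. by rewrite lfunE /= symmetric_formC. Qed.

Lemma form_dual_fun_linear : linear form_dual_fun.
Proof.
move=> a u v; apply/lfunP => w.
by rewrite add_lfunE scale_lfunE !form_dual_funE linearPl.
Qed.
HB.instance Definition _ :=
  GRing.isLinear.Build K V 'Hom(V, K^o) *:%R form_dual_fun form_dual_fun_linear.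

Definition form_dual : 'Hom(V, 'Hom(V, K^o)) := linfun form_dual_fun.

Lemma form_dualE u v : form_dual u v = B u v.
Proof. by rewrite lfunE form_dual_funE. Qed.

Lemma nondegenerate_eq0 u : nondegenerate B -> (forall v, B u v = 0) -> u = 0.
Proof.
move=> /eqP radB u0; apply/eqP; rewrite -memv0 -radB.
by apply/mem_orthovP => v _; apply: u0.
Qed.

Lemma form_riesz : nondegenerate B ->
  exists r : 'Hom('Hom(V, K^o), V), forall f v, B (r f) v = f v.
Proof.
move=> B_nondeg.
have ker0 : lker form_dual = 0%VS.
  apply/eqP; rewrite -subv0; apply/subvP => u; rewrite memv_ker memv0 => /eqP u0.
  by apply/eqP/nondegenerate_eq0 => // v; rewrite -form_dualE u0 zero_lfunE.
have full : limg form_dual = fullv.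
  apply/eqP; rewrite eqEdim subvf limg_dim_eq ?ker0 ?capv0 //.
  by rewrite !dimvf /dim /= muln1.
exists form_dual^-1%VF => f v.
by rewrite -form_dualE limg_lfunVK // full memvf.
Qed.

(** Let p be any projection with kernel I, and p* its adjoint for B; p* takes
    values in the orthogonal of ker p, that is in I. Then pi = p - p* p / 2 is
    again a projection with kernel I, and the correction cancels B on its
    image, since B(p* p u, p v) = B(p u, p v). *)
Lemma isotropic_splitting (I : {vspace V}) : 2%:R != 0 :> K -> nondegenerate B ->
    (forall u, u \in I <-> forall v, v \in I -> B u v = 0) ->
  exists pi : 'End(V), [/\ forall u, pi (pi u) = pi u,
    forall u, pi u = 0 <-> u \in I & forall u v, B (pi u) (pi v) = 0].
Proof.
move=> two0 B_nondeg I_lag; have [r rP] := form_riesz B_nondeg.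
pose p : 'End(V) := (\1 - projv I)%VF.
have pE u : p u = u - projv I u by rewrite add_lfunE opp_lfunE id_lfunE.
have p0 u : u \in I -> p u = 0 by move=> uI; rewrite pE projv_id ?subrr.
have pI u : u - p u \in I by rewrite pE subKr memv_proj.
have pK u : p (p u) = p u.
  by apply/esym; apply/eqP; rewrite -subr_eq0; have := p0 _ (pI u); rewrite linearB => ->.
(* q is p* p *)
pose q u := r (form_dual (p u) \o p)%VF.
have qE u v : B (q u) v = B (p u) (p v) by rewrite rP comp_lfunE form_dualE.
have qI u : q u \in I by apply/I_lag => v vI; rewrite qE (p0 _ vI) linear0r.
have [pi piE] : exists pi : 'End(V), forall u, pi u = p u - 2%:R^-1 *: q u.
  apply: lfun_of_linear => a u v.
  rewrite /q linearP /= linearP comp_lfunDl -comp_lfunZl linearP /=.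
  by rewrite scalerDr !scalerA (mulrC _ a) -!scalerA opprD addrACA -scalerBr.
have pi_p u : p (pi u) = p u by rewrite piE linearB linearZ /= pK (p0 (q u)) ?scaler0 ?subr0.
have qp u v : p u = p v -> q u = q v by rewrite /q => ->.
exists pi; split=> [u|u|u v].
- by rewrite piE pi_p (qp (pi u) u) // -piE.
- split=> [pi0|uI]; last by rewrite piE /q p0 // linear0 comp_lfun0l linear0 scaler0 subr0.
  by have := pI u; rewrite -pi_p pi0 linear0 subr0.
have qp_form x y : B (q x) (p y) = B (p x) (p y) by rewrite qE pK.
have pq_form x y : B (p x) (q y) = B (p x) (p y).
  by rewrite symmetric_formC qp_form symmetric_formC.
have qq_form x y : B (q x) (q y) = 0 by apply: (I_lag _).1.
rewrite !piE linearBl !linearBr !linearZl_LR !linearZr_LR /=.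
rewrite qp_form pq_form qq_form !mulr0 subr0 -addrA -opprD -mulrDl.
have -> : 2%:R^-1 + 2%:R^-1 = 1 :> K by rewrite -[_^-1]mul1r -mulrDl divff.
by rewrite mul1r subrr.
Qed.

End SymmetricForm.

(** * Lagrangian ideals *)

Section LagrangianIdeal.
Variables (K : closedFieldType) (K0 : [pchar K] =i pred0) (g : lieAlgType K).
Variables (B : {symmetric g}) (D : 'End(g)).
Hypotheses (B_inv : forall x y z, B [lie x, y] z = B x [lie y, z]).
Hypotheses (D_der : is_derivation D) (D_bij : bijective D) (D_skew : is_skew_wrt B D).

(** A stable isotropic ideal W that is not Lagrangian can be enlarged by an
    eigenvector of D among the g-invariants of the quotient of its orthogonal
    by W: the eigenvalue is nonzero, so skewness makes the vector
    isotropic. *)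
Lemma lagrangian_ideal : exists I : {vspace g},
  [/\ stable D I, acts_on fullv I &
      forall u, u \in I <-> forall v, v \in I -> B u v = 0].
Proof.
suff ext m W : (\dim {:g} - \dim W <= m)%N -> stable D W -> acts_on fullv W ->
    (W <= orthov B W)%VS ->
    exists I : {vspace g}, [/\ stable D I, acts_on fullv I & orthov B I = I].
  have mem0 v : v \in 0%VS -> v = 0 :> g by rewrite memv0 => /eqP.
  have [u /mem0->|x u _ /mem0->||I [ID gI I_lag]] := ext _ 0%VS (leqnn _).
  - by rewrite linear0 mem0v.
  - by rewrite linear0r mem0v.
  - exact: sub0v.
  exists I; split=> // u; rewrite -{1}I_lag.
  by split=> [/mem_orthovP|uI]; last exact/mem_orthovP.
elim: m W => [|m IH] W dimW WD gW W_iso;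
  have [sub|not_sub] := boolP (orthov B W <= W)%VS;
  try by (exists W; split=> //; apply/eqP; rewrite eqEsubv sub).
  case/negP: not_sub; apply: (subv_trans (subvf _)).
  by rewrite -(geq_leqif (dimv_leqif_sup (subvf W))) -subn_eq0 -leqn0.
have W'D : stable D (orthov B W).
  move=> u /mem_orthovP uW; apply/mem_orthovP => w wW.
  by rewrite D_skew uW ?oppr0 ?WD.
have gW' : acts_on fullv (orthov B W).
  move=> x u xg /mem_orthovP uW; apply/mem_orthovP => w wW.
  by rewrite lie_anticomm linearNl /= B_inv uW ?oppr0 ?gW.
have N_W := has_invariants_mod_full K0 D_der D_bij WD W'D gW gW' not_sub.
have N_D : stable D (orthov B W :&: transporter fullv W)%VS.
  by apply/stableI/transporter_stable => // x _; apply: memvf.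
have [v [a [vN v_notW Dv]]] := eigenvector_mod N_D N_W.
move: vN; rewrite memv_cap => /andP[/mem_orthovP vW /transporterP v_tr].
have a0 : a != 0.
  apply: contraNneq v_notW => a0; apply: (stable_cancel D_bij WD).
  by rewrite a0 scale0r subr0 in Dv.
(* skewness gives 2 a B(v,v) = 0, as D v = a v modulo W and B(v,W) = 0 *)
have vv : B v v = 0.
  have Dvv : B (D v) v = a * B v v.
    rewrite -[D v](subrK (a *: v)) linearDl linearZl_LR /=.
    by rewrite symmetric_formC vW // add0r.
  have /eqP := D_skew v v; rewrite (symmetric_formC B v) Dvv -addr_eq0 -mulr2n.
  by rewrite -mulr_natl !mulf_eq0 (pcharf0P K).1 // (negPf a0) => /eqP.
have v_in : v \in (W + <[v]>)%VS by rewrite memvE addvSr.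
apply: (IH (W + <[v]>)%VS).
- rewrite -ltnS (leq_trans _ dimW) // ltn_sub2l //.
    rewrite ltn_neqAle dimvS ?subvf // andbT; apply: contra v_notW => /eqP eq_dim.
    by have /eqP-> : W == fullv; [rewrite eqEdim subvf eq_dim /=|exact: memvf].
  rewrite ltn_neqAle dimvS ?addvSl // andbT; apply: contra v_notW => /eqP eq_dim.
  by have /eqP-> : W == (W + <[v]>)%VS; [rewrite eqEdim addvSl -eq_dim /=|].
- exact: stable_adjoin Dv.
- move=> x _ xg /memv_addP[w wW [_ /vlineP[b ->] ->]].
  rewrite linearDr linearZr /=; apply: (subvP (addvSl W <[v]>%VS)).
  by apply: memvD; [apply: gW|apply/memvZ/v_tr].
apply/orthovP => _ _ /memv_addP[w wW [_ /vlineP[b ->] ->]]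
  /memv_addP[w' w'W [_ /vlineP[b' ->] ->]].
rewrite linearDl !linearDr !linearZl_LR !linearZr_LR /= vv.
by rewrite (orthovP W_iso) // (symmetric_formC B w) !vW // !(mulr0, addr0).
Qed.

End LagrangianIdeal.

(** * The quotient by an ideal, on the image of a projection *)

Section QuotientAlgebra.
Variables (K : fieldType) (g : lieAlgType K) (pi : 'End(g)).
Implicit Types (u v w : g).

Definition idempotent_map := forall u, pi (pi u) = pi u.
Definition ideal_kernel := forall u v, pi u = 0 -> pi [lie u, v] = 0.

(** The quotient of g by the ideal ker pi, carried by the image of pi. The two
    properties of pi are arguments of the type because the Lie algebra
    structure depends on them. *)
Definition quotient_algebra of idempotent_map & ideal_kernel : Type :=
  subvs_of (limg pi).

Variables (pi_idem : idempotent_map) (pi_ideal : ideal_kernel).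
Local Notation a := (quotient_algebra pi_idem pi_ideal).
Implicit Types (x y z : a).

HB.instance Definition _ := Vector.copy a (subvs_of (limg pi)).

Definition rep : 'Hom(a, g) := linfun (vsval : a -> g).
Definition cls : 'Hom(g, a) := (linfun (vsproj (limg pi) : g -> a) \o pi)%VF.

Lemma rep_cls u : rep (cls u) = pi u.
Proof. by rewrite comp_lfunE !lfunE /= vsprojK // memv_img ?memvf. Qed.

Lemma pi_rep x : pi (rep x) = rep x.
Proof.
have /memv_imgP[u _ ->] : rep x \in limg pi by rewrite lfunE subvsP.
exact: pi_idem.
Qed.

Lemma rep_inj : injective rep.
Proof. by move=> x y; rewrite !lfunE => /subvs_inj. Qed.

Lemma rep_eq0 x : rep x = 0 -> x = 0.
Proof. by move=> x0; apply: rep_inj; rewrite x0 linear0. Qed.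

Lemma cls_rep x : cls (rep x) = x.
Proof. by apply: rep_inj; rewrite rep_cls pi_rep. Qed.

Lemma pi_complement u : pi (u - pi u) = 0.
Proof. by rewrite linearB /= pi_idem subrr. Qed.

Lemma pi_lie u v : pi [lie pi u, pi v] = pi [lie u, v].
Proof.
have pil u' v' : pi [lie pi u', v'] = pi [lie u', v'].
  apply/eqP; rewrite eq_sym -subr_eq0 -(linearB pi) -linearBl /=.
  by rewrite pi_ideal ?pi_complement.
by rewrite pil lie_anticomm linearN /= pil -linearN /= -lie_anticomm.
Qed.

Definition quotient_bracket x y : a := cls [lie rep x, rep y].

Fact quotient_bracket_bilinear :
  bilinear_for (GRing.Scale.Law.clone _ _ *:%R _)
    (GRing.Scale.Law.clone _ _ *:%R _) quotient_bracket.
Proof.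
by split=> x c y z; rewrite /quotient_bracket linearP ?linearPl ?linearPr linearP.
Qed.
HB.instance Definition _ :=
  bilinear_isBilinear.Build K a a a _ _ quotient_bracket quotient_bracket_bilinear.

Fact quotient_alternating x : quotient_bracket x x = 0.
Proof. by rewrite /quotient_bracket lie_alternating linear0. Qed.

Lemma rep_bracket x y : rep (quotient_bracket x y) = pi [lie rep x, rep y].
Proof. exact: rep_cls. Qed.

Fact quotient_jacobi x y z :
  quotient_bracket (quotient_bracket x y) z + quotient_bracket (quotient_bracket y z) x
    + quotient_bracket (quotient_bracket z x) y = 0.
Proof.
have lieE u v w : pi u = pi v -> pi [lie u, w] = pi [lie v, w].
  by move=> uv; rewrite -pi_lie uv pi_lie.
apply: rep_inj; rewrite !linearD linear0 /= !rep_bracket.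
rewrite !(lieE (pi _) _ _ (pi_idem _)) -!linearD lie_jacobi.
exact: linear0.
Qed.

HB.instance Definition _ :=
  Vector_isLieAlgebra.Build K a quotient_alternating quotient_jacobi.

Lemma rep_lie x y : rep [lie x, y] = pi [lie rep x, rep y].
Proof. exact: rep_cls. Qed.

End QuotientAlgebra.

(** * The T*-extension attached to a Lagrangian ideal *)

Section TstarModel.
Variables (K : fieldType) (K0 : [pchar K] =i pred0) (g : lieAlgType K).
Variables (B : {symmetric g}) (pi : 'End(g)).
Variables (pi_idem : idempotent_map pi) (pi_ideal : ideal_kernel pi).
Hypotheses (B_nondeg : nondegenerate B)
  (B_inv : forall u v w, B [lie u, v] w = B u [lie v, w]).
Hypothesis pi_isotropic : forall u v, B (pi u) (pi v) = 0.
Hypothesis ker_lagrangian : forall u, pi u = 0 <-> forall v, pi v = 0 -> B u v = 0.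
Local Notation a := (quotient_algebra pi_idem pi_ideal).
Local Notation rep := (rep pi_idem pi_ideal).
Local Notation cls := (cls pi_idem pi_ideal).
Implicit Types (u v w : g) (x y z : a).

(** Both ker pi and the image of pi are isotropic, so only the mixed terms of
    B(u, v) survive. *)
Lemma form_split u v : B u v = B (pi u) v + B u (pi v).
Proof.
have /eqP := (ker_lagrangian _).1 (pi_complement pi_idem u) _ (pi_complement pi_idem v).
rewrite linearBl !linearBr /= pi_isotropic subr0 -addrA -opprD subr_eq0 => /eqP->.
exact: addrC.
Qed.

Definition cocycle_fun x y : 'Hom(a, K^o) := (form_dual B [lie rep x, rep y] \o rep)%VF.

Lemma cocycle_funE x y z : cocycle_fun x y z = B [lie rep x, rep y] (rep z).
Proof. by rewrite comp_lfunE form_dualE. Qed.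

Fact cocycle_fun_bilinear :
  bilinear_for (GRing.Scale.Law.clone _ _ *:%R _)
    (GRing.Scale.Law.clone _ _ *:%R _) cocycle_fun.
Proof.
split=> x c y z; apply/lfunP => w.
  by rewrite add_lfunE scale_lfunE !cocycle_funE linearP !linearPl.
by rewrite add_lfunE scale_lfunE !cocycle_funE linearP linearPr linearPl.
Qed.
HB.instance Definition _ := bilinear_isBilinear.Build K a a 'Hom(a, K^o) _ _
  cocycle_fun cocycle_fun_bilinear.

Definition lagrangian_cocycle : {bilinear a -> a -> 'Hom(a, K^o)} := cocycle_fun.

Lemma lagrangian_cocycleE x y z :
  lagrangian_cocycle x y z = B [lie rep x, rep y] (rep z).
Proof. exact: cocycle_funE. Qed.

Lemma lagrangian_cocycle_cyclic : is_cyclic lagrangian_cocycle.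
Proof.
move=> x y z; rewrite [LHS]lagrangian_cocycleE [RHS]lagrangian_cocycleE.
by rewrite B_inv symmetric_formC.
Qed.

(** By [form_split] the two terms of the cocycle condition add up to
    B([[x,y],z],w), and the cyclic sum is the Jacobi identity of g. *)
Lemma lagrangian_cocycle_2cocycle : is_2cocycle lagrangian_cocycle.
Proof.
split=> [x y|x y z]; apply/lfunP => w.
  rewrite opp_lfunE [LHS]lagrangian_cocycleE lagrangian_cocycleE.
  by rewrite lie_anticomm linearNl.
have termE x' y' z' : cocycle_term lagrangian_cocycle x' y' z' w =
    B [lie [lie rep x', rep y'], rep z'] (rep w).
  rewrite add_lfunE [X in _ + X]comp_lfunE adE [X in X + _]lagrangian_cocycleE.
  by rewrite lagrangian_cocycleE !rep_lie !(B_inv _ (rep z')) -form_split.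
rewrite add_lfunE [X in X + _]add_lfunE !termE -!linearDl lie_jacobi zero_lfunE.
exact: linear0l.
Qed.

Local Notation T := (Tstar K0 lagrangian_cocycle_2cocycle).

(** The second component is B(u, -) restricted to the isotropic image of pi, so
    it sees only the part of u in ker pi, which it identifies with the dual
    of a. *)
Definition Tstar_coord_fun u : T := (cls u, (form_dual B u \o rep)%VF).

Lemma Tstar_coord_snd u z : (Tstar_coord_fun u).2 z = B u (rep z).
Proof. by rewrite comp_lfunE form_dualE. Qed.

Lemma Tstar_coord_linear : linear Tstar_coord_fun.
Proof.
move=> c u v; apply: Tstar_eqP => [|z] /=; first by rewrite linearP.
by rewrite linearP /= add_lfunE scale_lfunE !comp_lfunE add_lfunE scale_lfunE.
Qed.

(** The kernel of pi is an abelian ideal: B([u,v],w) vanishes for u, v in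
    ker pi because [v,w] is in ker pi again. Expanding this for u - pi u and
    v - pi v gives the second component. *)
Lemma Tstar_coord_lie u v :
  Tstar_coord_fun [lie u, v] = [lie Tstar_coord_fun u, Tstar_coord_fun v].
Proof.
apply: Tstar_eqP => [|z].
  by apply: (@rep_inj _ _ _ pi_idem pi_ideal); rewrite rep_lie !rep_cls pi_lie.
rewrite [RHS]Tstar_bracketE !Tstar_coord_snd /=.
rewrite !rep_lie !rep_cls; set w := rep z.
have piB t s : B t (pi s) = B t s - B (pi t) s by rewrite (form_split t s) addrC addKr.
have ker_ker : B [lie u - pi u, v - pi v] w = 0.
  rewrite B_inv; apply: (ker_lagrangian _).1; first exact: pi_complement.
  exact/pi_ideal/pi_complement.
have skewB t s : B t [lie s, w] = - B [lie s, t] w.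
  by rewrite -B_inv lie_anticomm linearNl.
have := ker_ker; rewrite !linearBl !linearBr !linearBl /= !piB !(skewB v) !(skewB (pi v)).
rewrite -!B_inv => ker0; apply/eqP; rewrite -subr_eq0 -[X in _ == X]ker0; apply/eqP.
ring.
Qed.

Lemma Tstar_coord_isometry u v :
  Tstar_form (Tstar_coord_fun u) (Tstar_coord_fun v) = B u v.
Proof.
rewrite /Tstar_form !Tstar_coord_snd !rep_cls addrC.
by rewrite symmetric_formC -form_split.
Qed.

Lemma Tstar_coord_bijective : bijective Tstar_coord_fun.
Proof.
have [r rP] := form_riesz B_nondeg.
(* r represents t.2 by a vector orthogonal to ker pi, hence lying in ker pi *)
pose inv (t : T) := rep t.1 + r (t.2 \o cls)%VF.
have r_ker t : pi (r (t \o cls)%VF) = 0.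
  apply/ker_lagrangian => v pv; rewrite rP comp_lfunE.
  have -> : cls v = 0 by apply: (@rep_eq0 _ _ _ pi_idem pi_ideal); rewrite rep_cls.
  by rewrite linear0.
have invK : cancel inv Tstar_coord_fun.
  move=> t; apply: Tstar_eqP => [|z] /=.
    apply: (@rep_inj _ _ _ pi_idem pi_ideal).
    by rewrite rep_cls linearD /= r_ker addr0 pi_rep.
  rewrite Tstar_coord_snd linearDl /= rP comp_lfunE cls_rep.
  by rewrite -(pi_rep t.1) -(pi_rep z) pi_isotropic add0r.
have inj : injective Tstar_coord_fun.
  move=> u v uv; apply/eqP; rewrite -subr_eq0; apply/eqP.
  apply: (nondegenerate_eq0 B_nondeg) => w.
  by rewrite linearBl /= -!Tstar_coord_isometry uv subrr.
exact: Bijective (inj_can_sym invK inj) invK.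
Qed.

Lemma isometrically_isomorphic_Tstar :
  isometrically_isomorphic B (@Tstar_form K K0 a _ lagrangian_cocycle_2cocycle).
Proof.
have [phi phiE] := lfun_of_linear Tstar_coord_linear.
exists phi; split=> [|u v|u v].
- exact: eq_bij Tstar_coord_bijective _ (fsym phiE).
- by rewrite !phiE Tstar_coord_lie.
- by rewrite !phiE; apply: Tstar_coord_isometry.
Qed.

Variable D : 'End(g).
Hypotheses (D_der : is_derivation D) (D_bij : bijective D) (D_skew : is_skew_wrt B D).
Hypothesis ker_stable : forall u, pi u = 0 -> pi (D u) = 0.

Definition induced_derivation : 'End(a) := (cls \o (D \o rep))%VF.

Lemma rep_induced_derivation x : rep (induced_derivation x) = pi (D (rep x)).
Proof. by rewrite comp_lfunE rep_cls comp_lfunE. Qed.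

Lemma pi_D u : pi (D (pi u)) = pi (D u).
Proof.
apply/esym/eqP; rewrite -subr_eq0 -!linearB /=; apply/eqP/ker_stable.
exact: pi_complement.
Qed.

Lemma induced_derivation_der : is_derivation induced_derivation.
Proof.
move=> x y; apply: rep_inj.
rewrite linearD /= !rep_lie !rep_induced_derivation !rep_lie pi_D D_der linearD /=.
by rewrite -(pi_lie pi_idem pi_ideal (D _)) -(pi_lie pi_idem pi_ideal _ (D _)) !pi_rep.
Qed.

Lemma induced_derivation_bij : bijective induced_derivation.
Proof.
have ker0 : lker induced_derivation == 0%VS.
  rewrite -subv0; apply/subvP => x; rewrite memv_ker memv0 => /eqP x0; apply/eqP.
  apply: rep_eq0; rewrite -pi_rep; apply/eqP; rewrite -memv_ker.
  apply: (stable_cancel D_bij) => [u|]; rewrite !memv_ker.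
    by move=> /eqP/ker_stable->.
  by rewrite -rep_induced_derivation x0 linear0.
exact: Bijective (lker0_lfunK ker0) (lker0_lfunVK ker0).
Qed.

(** The invariant trilinear form B([u,v],w) is annihilated by every
    skew-symmetric derivation. *)
Lemma skew_derivation_sum u v w :
  B (D u) [lie v, w] + B (D v) [lie w, u] + B (D w) [lie u, v] = 0.
Proof.
have -> : B (D u) [lie v, w] = B w [lie D u, v] by rewrite -B_inv symmetric_formC.
have -> : B (D v) [lie w, u] = B w [lie u, D v] by rewrite symmetric_formC B_inv.
by rewrite (D_skew w) D_der -linearDr subrr.
Qed.

(** As the image of pi is isotropic, only the component of D (rep x) in ker pi
    contributes. *)
Definition derivation_form x y : K := B (D (rep x)) (rep y).

Fact derivation_form_bilinear :
  bilinear_for (GRing.Scale.Law.clone _ _ *%R _)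
    (GRing.Scale.Law.clone _ _ *%R _) derivation_form.
Proof.
split=> x c y z; rewrite /derivation_form.
  by rewrite !linearP linearPl.
by rewrite linearP linearPr.
Qed.
HB.instance Definition _ := bilinear_isBilinear.Build K a a K _ _
  derivation_form derivation_form_bilinear.

(** Subtracting from B(D x, [y,z]) the contribution of the component of D x in
    ker pi leaves theta(D x, y)(z); sum cyclically and use
    [skew_derivation_sum]. *)
Lemma derivation_cocycle_coboundary :
  is_3coboundary (fun x y z : a =>
    lagrangian_cocycle (induced_derivation x) y z
    + lagrangian_cocycle (induced_derivation y) z x
    + lagrangian_cocycle (induced_derivation z) x y).
Proof.
exists derivation_form; split=> [x|x y z].
  have /eqP := D_skew (rep x) (rep x); rewrite symmetric_formC -addr_eq0 -mulr2n.
  rewrite -mulr_natl mulf_eq0 (pcharf0P K).1 //= => /eqP.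
  by rewrite symmetric_formC.
have termE x' y' z' : lagrangian_cocycle (induced_derivation x') y' z' =
    B (D (rep x')) [lie rep y', rep z'] + derivation_form [lie y', z'] x'.
  rewrite [LHS]lagrangian_cocycleE rep_induced_derivation B_inv.
  have -> : derivation_form [lie y', z'] x' =
      - B (D (rep x')) (pi [lie rep y', rep z']).
    by rewrite /derivation_form rep_lie D_skew symmetric_formC.
  by rewrite (form_split (D _)) addrK.
have sum0 := skew_derivation_sum (rep x) (rep y) (rep z).
rewrite !termE; apply/eqP; rewrite -subr_eq0 -[X in _ == X]sum0; apply/eqP.
ring.
Qed.

End TstarModel.

(** * Quadratic Lie algebras with an invertible skew-symmetric derivation *)

Theorem theorem2p3 (K : closedFieldType) (K0 : [pchar K] =i pred0)
    (g : lieAlgType K) (B : {symmetric g}) (B_quadratic : is_quadratic B)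
    (Dbar : 'End(g)) (Dbar_derivation : is_derivation Dbar)
    (Dbar_invertible : bijective Dbar) (Dbar_skew : is_skew_wrt B Dbar) :
  exists (a : lieAlgType K) (D : 'End(a))
      (theta : {bilinear a -> a -> 'Hom(a, K^o)})
      (theta_cocycle : is_2cocycle theta),
    [/\ is_derivation D /\ bijective D,
        is_cyclic theta,
        isometrically_isomorphic B (@Tstar_form K K0 a theta theta_cocycle) &
        is_3coboundary (fun x y z : a =>
          theta (D x) y z + theta (D y) z x + theta (D z) x y)].
Proof.
have [B_nondeg B_inv] := B_quadratic.
have [I [I_stable I_ideal I_lag]] :=
  lagrangian_ideal K0 B_inv Dbar_derivation Dbar_invertible Dbar_skew.
have two0 : 2%:R != 0 :> K by rewrite (pcharf0P K).1.
have [pi [pi_idem ker_pi pi_iso]] := isotropic_splitting two0 B_nondeg I_lag.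
have pi_ideal : ideal_kernel pi.
  move=> u v /ker_pi uI; apply/ker_pi.
  by rewrite lie_anticomm memvN I_ideal ?memvf.
have ker_lag u : pi u = 0 <-> forall v, pi v = 0 -> B u v = 0.
  by rewrite ker_pi I_lag; split=> u_orth v /ker_pi; apply: u_orth.
have ker_stable u : pi u = 0 -> pi (Dbar u) = 0.
  by move=> /ker_pi/I_stable/ker_pi.
exists (quotient_algebra pi_idem pi_ideal).
exists (induced_derivation pi_idem pi_ideal Dbar).
exists (lagrangian_cocycle B pi_idem pi_ideal).
exists (lagrangian_cocycle_2cocycle pi_idem pi_ideal B_inv pi_iso ker_lag).
split.
- split; first exact: induced_derivation_der.
  exact: induced_derivation_bij.
- exact: lagrangian_cocycle_cyclic.
- exact: isometrically_isomorphic_Tstar.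
- exact: derivation_cocycle_coboundary.
Qed.
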